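(* Both the functor $\Sigma^*\colon\mathsf{DDS}\to\mathsf{MultiDiGraph}$ and the state space functor $S\colon\mathsf{DDS}\to\mathsf{DiGraph}$ are full and faithful.
   Context: $\mathsf{DDS}$ is the category of discrete dynamical systems: objects are pairs $(X,f)$ with $X$ a set and $f\colon X\to X$ a function, morphisms $(X,f)\to(Y,g)$ are functions $\alpha$ with $\alpha f=g\alpha$ (equivalently, functors $B\mathbb{N}\to\mathsf{Set}$, with $B\mathbb{N}$ the one-object category of the monoid $(\mathbb{N},+)$). $\mathsf{MultiDiGraph}$ is the category of presheaves on the category with two objects $V,E$ and two non-identity morphisms $s,t\colon V\to E$; thus a multidigraph $G$ has a vertex set $V(G)$, an edge set $E(G)$, and source and target maps $E(G)\to V(G)$. $\mathsf{DiGraph}$ is the full subcategory of multidigraphs for which $(\mathrm{source},\mathrm{target})\colon E(G)\to V(G)\times V(G)$ is injective. $\Sigma^*(X,f)$ has vertex set $X$ and one edge $x\to f(x)$ for each $x\in X$, with $\Sigma^*$ acting on morphisms in the evident way (it is restriction along the functor sending $s,t$ to $0,1\in\mathbb{N}$). It takes values in digraphs, and $S$ is $\Sigma^*$ regarded as a functor to $\mathsf{DiGraph}$. *)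

(* Defs.v *)
From Stdlib Require Import FunctionalExtensionality ProofIrrelevance.

Set Implicit Arguments.
Unset Strict Implicit.
Unset Printing Implicit Defensive.

Local Obligation Tactic := intros; cbv beta; try reflexivity.

Declare Scope cat_scope.
Delimit Scope cat_scope with cat.
Local Open Scope cat_scope.

Record category : Type := Category {
  ob :> Type;
  hom : ob -> ob -> Type;
  idm : forall a, hom a a;
  compose : forall a b c, hom b c -> hom a b -> hom a c;
  compose_id_l : forall a b (f : hom a b), compose (idm b) f = f;
  compose_id_r : forall a b (f : hom a b), compose f (idm a) = f;
  compose_assoc : forall a b c d (h : hom c d) (g : hom b c) (f : hom a b),
    compose h (compose g f) = compose (compose h g) f
}.

Arguments hom {c} a b : rename.
Arguments idm {c} a : rename.
Arguments compose {c a1 a2 a3} g f : rename.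

Notation "g \o f" := (compose g f) (at level 40, left associativity) : cat_scope.

Record functor (C D : category) : Type := Functor {
  fobj :> C -> D;
  fmap : forall a b : C, hom a b -> hom (fobj a) (fobj b);
  fmap_id : forall a : C, fmap (idm a) = idm (fobj a);
  fmap_comp : forall (a b c : C) (g : hom b c) (f : hom a b),
    fmap (g \o f) = fmap g \o fmap f
}.

Arguments fmap {C D} F {a b} f : rename.

Definition full (C D : category) (F : functor C D) : Prop :=
  forall (a b : C) (g : hom (F a) (F b)), exists f : hom a b, fmap F f = g.

Definition faithful (C D : category) (F : functor C D) : Prop :=
  forall (a b : C) (f g : hom a b), fmap F f = fmap F g -> f = g.

Definition opposite (C : category) : category :=
  {| ob := C;
     hom := fun a b => @hom C b a;
     idm := fun a => @idm C a;
     compose := fun a b c g f => @compose C c b a f g;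
     compose_id_l := fun a b f => @compose_id_r C b a f;
     compose_id_r := fun a b f => @compose_id_l C b a f;
     compose_assoc := fun a b c d h g f =>
       eq_sym (@compose_assoc C d c b a f g h) |}.

Definition Sets : category :=
  {| ob := Type;
     hom := fun X Y => X -> Y;
     idm := fun X x => x;
     compose := fun X Y Z g f x => g (f x);
     compose_id_l := fun X Y f => eq_refl;
     compose_id_r := fun X Y f => eq_refl;
     compose_assoc := fun X Y Z W h g f => eq_refl |}.

Record nat_trans (C D : category) (F G : functor C D) : Type := NatTrans {
  component :> forall a : C, hom (F a) (G a);
  naturality : forall (a b : C) (f : hom a b),
    component b \o fmap F f = fmap G f \o component a
}.

Lemma nat_trans_eq (C D : category) (F G : functor C D) (u v : nat_trans F G) :
  (forall a, u a = v a) -> u = v.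
Proof.
destruct u as [u hu], v as [v hv]; simpl; intros e.
assert (E : u = v) by (apply functional_extensionality_dep; exact e).
subst v; f_equal; apply proof_irrelevance.
Qed.

Program Definition nat_trans_id (C D : category) (F : functor C D) :
  nat_trans F F := {| component := fun a => idm (F a) |}.
Next Obligation. now rewrite compose_id_l, compose_id_r. Qed.

Program Definition nat_trans_comp (C D : category) (F G H : functor C D)
    (v : nat_trans G H) (u : nat_trans F G) : nat_trans F H :=
  {| component := fun a => v a \o u a |}.
Next Obligation.
now rewrite <- compose_assoc, naturality, compose_assoc, naturality, compose_assoc.
Qed.

Program Definition functor_category (C D : category) : category :=
  {| ob := functor C D;
     hom := @nat_trans C D;
     idm := @nat_trans_id C D;
     compose := @nat_trans_comp C D |}.
Next Obligation. apply nat_trans_eq; intros x; apply compose_id_l. Qed.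
Next Obligation. apply nat_trans_eq; intros x; apply compose_id_r. Qed.
Next Obligation. apply nat_trans_eq; intros x; apply compose_assoc. Qed.

Definition presheaves (C : category) : category :=
  functor_category (opposite C) Sets.

Definition full_subcategory (C : category) (P : C -> Prop) : category :=
  {| ob := {a : C | P a};
     hom := fun a b => hom (proj1_sig a) (proj1_sig b);
     idm := fun a => idm (proj1_sig a);
     compose := fun a b c g f => g \o f;
     compose_id_l := fun a b f => compose_id_l f;
     compose_id_r := fun a b f => compose_id_r f;
     compose_assoc := fun a b c d h g f => compose_assoc h g f |}.

Definition corestrict (C D : category) (P : D -> Prop) (F : functor C D)
    (FP : forall a : C, P (F a)) : functor C (full_subcategory P) :=
  @Functor C (full_subcategory P)
    (fun a => exist P (F a) (FP a))
    (fun a b f => fmap F f)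
    (fun a => fmap_id F a)
    (fun a b c g f => fmap_comp F g f).

Record dds : Type := DDS_of {
  dds_set : Sets;
  dds_map : @hom Sets dds_set dds_set
}.

Arguments dds_map X : clear implicits, rename.

Record dds_hom (X Y : dds) : Type := DDSHom {
  dds_fun : @hom Sets (dds_set X) (dds_set Y);
  dds_funP : dds_fun \o dds_map X = dds_map Y \o dds_fun
}.

Arguments dds_fun {X Y} u : rename.
Arguments dds_funP {X Y} u : rename.

Lemma dds_hom_eq (X Y : dds) (u v : dds_hom X Y) :
  dds_fun u = dds_fun v -> u = v.
Proof.
destruct u as [u hu], v as [v hv]; simpl; intros e.
subst v; f_equal; apply proof_irrelevance.
Qed.

Program Definition dds_id (X : dds) : dds_hom X X :=
  {| dds_fun := @idm Sets (dds_set X) |}.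

Program Definition dds_comp (X Y Z : dds) (v : dds_hom Y Z) (u : dds_hom X Y) :
  dds_hom X Z := {| dds_fun := dds_fun v \o dds_fun u |}.
Next Obligation.
now rewrite <- compose_assoc, dds_funP, compose_assoc, dds_funP, compose_assoc.
Qed.

Program Definition DDS : category :=
  {| ob := dds; hom := dds_hom; idm := dds_id; compose := dds_comp |}.
Next Obligation. now apply dds_hom_eq. Qed.
Next Obligation. now apply dds_hom_eq. Qed.
Next Obligation. now apply dds_hom_eq. Qed.

Inductive pp_ob : Type := V_ | E_.
Inductive pp_arrow : Type := s_ | t_.

Definition pp_hom (a b : pp_ob) : Type :=
  match a, b with
  | V_, V_ | E_, E_ => unit
  | V_, E_ => pp_arrow
  | E_, V_ => Empty_set
  end.

Definition pp_id (a : pp_ob) : pp_hom a a :=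
  match a with V_ => tt | E_ => tt end.

Definition pp_comp (a b c : pp_ob) : pp_hom b c -> pp_hom a b -> pp_hom a c :=
  match a, b, c with
  | V_, V_, V_ => fun _ _ => tt
  | V_, V_, E_ => fun g _ => g
  | V_, E_, E_ => fun _ f => f
  | E_, E_, E_ => fun _ _ => tt
  | _, E_, V_ => fun g _ => match g with end
  | E_, V_, _ => fun _ f => match f with end
  end.

Program Definition parallel_pair : category :=
  {| ob := pp_ob; hom := pp_hom; idm := pp_id; compose := pp_comp |}.
Next Obligation. destruct a, b; destruct f; reflexivity. Qed.
Next Obligation. destruct a, b; destruct f; reflexivity. Qed.
Next Obligation.
destruct a, b, c, d, h, g, f; reflexivity.
Qed.

Definition MultiDiGraph : category := presheaves parallel_pair.

Definition vertices (G : MultiDiGraph) : Type := fobj G V_.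
Definition edges (G : MultiDiGraph) : Type := fobj G E_.

Definition source (G : MultiDiGraph) : edges G -> vertices G :=
  @fmap (opposite parallel_pair) Sets G E_ V_ s_.
Definition target (G : MultiDiGraph) : edges G -> vertices G :=
  @fmap (opposite parallel_pair) Sets G E_ V_ t_.

Definition is_digraph (G : MultiDiGraph) : Prop :=
  forall e e' : edges G,
    (source e, target e) = (source e', target e') -> e = e'.

Definition DiGraph : category := full_subcategory is_digraph.

(* The edge indexed by [x] is [x -> f x]. *)
Definition sigma_map (X : dds) (a b : pp_ob) : pp_hom b a -> dds_set X -> dds_set X :=
  match b, a with
  | V_, E_ => fun i => match i with s_ => fun x => x | t_ => dds_map X end
  | _, _ => fun _ x => x
  end.

Program Definition sigma_obj (X : dds) : MultiDiGraph :=
  @Functor (opposite parallel_pair) Sets (fun _ => dds_set X) (@sigma_map X) _ _.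
Next Obligation. destruct a; reflexivity. Qed.
Next Obligation.
destruct a, b, c, g, f; reflexivity.
Qed.

Program Definition sigma_hom (X Y : dds) (u : dds_hom X Y) :
  @hom MultiDiGraph (sigma_obj X) (sigma_obj Y) :=
  @NatTrans (opposite parallel_pair) Sets (sigma_obj X) (sigma_obj Y)
    (fun _ => dds_fun u) _.
Next Obligation.
destruct a, b; destruct f; solve [reflexivity | exact (dds_funP u)].
Qed.

Program Definition Sigma_star : functor DDS MultiDiGraph :=
  @Functor DDS MultiDiGraph sigma_obj sigma_hom _ _.
Next Obligation. apply nat_trans_eq; reflexivity. Qed.
Next Obligation. apply nat_trans_eq; reflexivity. Qed.

Lemma Sigma_star_digraph (X : DDS) : is_digraph (Sigma_star X).
Proof. intros e e' h; exact (f_equal fst h). Qed.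

Definition state_space : functor DDS DiGraph := corestrict Sigma_star_digraph.

(* Main.v *)
(** A morphism of multidigraphs [g : Sigma^* X -> Sigma^* Y] consists of functions
    [g_V, g_E : X -> Y].  As the source maps are identities, compatibility with
    sources says [g_V = g_E]; compatibility with targets then says that this
    function commutes with the dynamics.  Corestriction to a full subcategory
    does not change the hom-sets. *)

Require Import Defs.

Lemma full_Sigma_star : full Sigma_star.
Proof.
intros X Y g.
(* The ascribed type holds by conversion: [s_] acts as the identity on both sides of the naturality
   square. *)
pose proof (@naturality _ _ _ _ g E_ V_ s_ : g V_ = g E_) as gs.
pose proof (@naturality _ _ _ _ g E_ V_ t_) as gt.
rewrite <- gs in gt.
exists (@DDSHom X Y (g V_) gt).
apply nat_trans_eq; intros [|]; [reflexivity | exact gs].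
Qed.

(** The vertex component of the image of a morphism is its underlying function, which determines
    it. *)
Lemma faithful_Sigma_star : faithful Sigma_star.
Proof.
intros X Y u v e; apply dds_hom_eq.
exact (f_equal (fun w : @hom MultiDiGraph _ _ => component w V_) e).
Qed.

Lemma full_corestrict (C D : category) (P : D -> Prop) (F : functor C D)
    (FP : forall a : C, P (F a)) : full F -> full (corestrict FP).
(* Hom-sets and action on morphisms agree definitionally, so both fullness statements are
   convertible. *)
Proof. exact (fun h => h). Qed.

Lemma faithful_corestrict (C D : category) (P : D -> Prop) (F : functor C D)
    (FP : forall a : C, P (F a)) : faithful F -> faithful (corestrict FP).
Proof. exact (fun h => h). Qed.

Theorem theorem1p19 :
  (full Sigma_star /\ faithful Sigma_star) /\
  (full state_space /\ faithful state_space).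
Proof.
split; split.
- exact full_Sigma_star.
- exact faithful_Sigma_star.
- exact (full_corestrict _ _ _ _ _ full_Sigma_star).
- exact (faithful_corestrict _ _ _ _ _ faithful_Sigma_star).
Qed.
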